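(* Let $N,d\ge 1$ and let $f_1,\dots,f_N:\mathbb R^d\to\mathbb R$ be convex functions such that $L_i:=\sup_{z\in\mathbb R^d}\sup_{g\in\partial f_i(z)}\|g\|_1<\infty$ for each $i$, and such that $f:=\sum_{i=1}^N f_i$ has at least one minimizer on $\mathbb R^d$. Let $P=(p_{ij})$ be an $N\times N$ row-stochastic and primitive matrix. Let $\alpha\in[-1,-1/2)$, $c>0$, and let $\delta(t)=ct^\alpha$ for $t\ge1$, with $\delta(0)\ge0$ arbitrary. Let $x_i(t)\in\mathbb R^d$ and $z_i(t)=(z_{i1}(t),\dots,z_{iN}(t))^\top\in\mathbb R^N$ satisfy, for $1\le i\le N$ and $t\ge 0$, $$x_i(t+1)=\sum_{j=1}^N p_{ij}x_j(t)-\frac{\delta(t)}{z_{ii}(t)}g_i(t),\qquad g_i(t)\in\partial f_i(x_i(t)),$$ $$z_i(t+1)=\sum_{j=1}^N p_{ij}z_j(t),\qquad z_i(0)=\mathbf e_i,$$ with arbitrary initial data $x_i(0)$, where it is assumed that $z_{ii}(t)\ne0$ for all $i$ and $t\ge0$ so that the recursion is well defined. Then there exists a minimizer $x^*$ of $f$ such that $\lim_{t\to\infty}x_i(t)=x^*$ for all $1\le i\le N$.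
   Context: A nonnegative square matrix is row-stochastic if each of its rows sums to $1$; it is primitive if some power $P^T$, $T\in\mathbb N$, has all entries positive. $\mathbf e_i$ is the $i$-th standard unit vector of $\mathbb R^N$. $\partial f_i(z)$ is the (convex) subdifferential of $f_i$ at $z$, and $\|g\|_1=\sum_l|g_l|$. *)

(* Defs.v *)
From HB Require Import structures.
From mathcomp Require Import all_boot all_order all_algebra.
From mathcomp Require Import all_classical all_reals all_analysis.

Set Implicit Arguments.
Unset Strict Implicit.
Unset Printing Implicit Defensive.

Import Order.TTheory GRing.Theory Num.Theory.
Import numFieldNormedType.Exports.

Local Open Scope classical_set_scope.
Local Open Scope ring_scope.

(* Vectors of R^n are row vectors. *)

Definition nonneg_mx (R : realType) (n : nat) (P : 'M[R]_n) : Prop :=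
  forall i j, 0 <= P i j.

Definition row_stochastic (R : realType) (n : nat) (P : 'M[R]_n) : Prop :=
  nonneg_mx P /\ forall i, \sum_j P i j = 1.

Definition primitive_mx (R : realType) (n : nat) (P : 'M[R]_n) : Prop :=
  nonneg_mx P /\ exists2 T : nat, (0 < T)%N & forall i j, 0 < (P ^+ T) i j.

(* The library's norm on 'rV[R]_d is the sup norm, hence a separate definition. *)
Definition norm1 (R : realType) (d : nat) (g : 'rV[R]_d) : R :=
  \sum_l `|g 0 l|.

Definition dotv (R : realType) (d : nat) (u v : 'rV[R]_d) : R :=
  \sum_l u 0 l * v 0 l.

Definition subdifferential (R : realType) (d : nat) (f : 'rV[R]_d -> R)
    (z : 'rV[R]_d) : set 'rV[R]_d :=
  [set g | forall y, f z + dotv g (y - z) <= f y].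

Definition subgradient_sup (R : realType) (d : nat) (f : 'rV[R]_d -> R)
    : \bar R :=
  ereal_sup (range (fun z =>
    ereal_sup [set (norm1 g)%:E | g in subdifferential f z])).

Definition is_minimizer (R : realType) (d : nat) (f : 'rV[R]_d -> R)
    (x : 'rV[R]_d) : Prop :=
  forall y, f x <= f y.

(* Main.v *)
Require Import Defs.
From HB Require Import structures.
From mathcomp Require Import all_boot all_order all_algebra.
From mathcomp Require Import all_classical all_reals all_analysis.
From mathcomp Require Import ring lra.

(* Let p be the Perron vector of P (p P = p) and m(t) = sum_j p_j x_j(t).  Since
   P^t converges geometrically to its limit 1 p, the deviations x_i(t) - m(t) are
   O(u(t)) where u(t+1) = r u(t) + O(delta(t)) with r < 1, so sum u^2 is finite
   because sum delta^2 is.  The weights z_ii(t) also converge geometrically to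
   p_i, hence m performs a perturbed subgradient descent on f: for every
   minimizer y, 1 + |m(t) - y|^2 satisfies a Robbins-Siegmund inequality with
   summable perturbation.  So |m(t) - y| converges and
   sum delta(t) (f(m(t)) - f(y)) is finite.  As sum delta diverges, f(m(t)) comes
   arbitrarily close to min f along a subsequence; a cluster point of that
   subsequence is a minimizer, and taking it as y forces m(t) to converge to y. *)

Set Implicit Arguments.
Unset Strict Implicit.
Unset Printing Implicit Defensive.

Import Order.TTheory GRing.Theory Num.Theory.
Import numFieldNormedType.Exports.

Local Open Scope classical_set_scope.
Local Open Scope ring_scope.

(** * Nonnegative series, encoded by bounded partial sums, and divergent weights *)

Definition summable_seq (R : realType) (a : nat -> R) : Prop :=
  (forall t, 0 <= a t) /\ exists M, forall n, \sum_(t < n) a t <= M.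

Lemma summable_seq_le (R : realType) (a b : nat -> R) :
  (forall t, 0 <= a t <= b t) -> summable_seq b -> summable_seq a.
Proof.
move=> ab [_ [M bM]]; split=> [t|]; first by have /andP[] := ab t.
exists M => n; apply: le_trans (bM n); apply: ler_sum => t _.
by have /andP[] := ab t.
Qed.

Lemma summable_seqD (R : realType) (a b : nat -> R) :
  summable_seq a -> summable_seq b -> summable_seq (fun t => a t + b t).
Proof.
move=> [a0 [A aA]] [b0 [B bB]]; split=> [t|]; first exact: addr_ge0.
by exists (A + B) => n; rewrite big_split lerD.
Qed.

Lemma summable_seqZ (R : realType) (k : R) (a : nat -> R) :
  0 <= k -> summable_seq a -> summable_seq (fun t => k * a t).
Proof.
move=> k0 [a0 [A aA]]; split=> [t|]; first exact: mulr_ge0.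
by exists (k * A) => n; rewrite -mulr_sumr ler_wpM2l.
Qed.

Lemma summable_seq_cvg (R : realType) (a : nat -> R) :
  summable_seq a -> cvgn (series a).
Proof.
move=> [a0 [M aM]]; apply: nondecreasing_is_cvgn.
  by apply: nondecreasing_series => n _ _; exact: a0.
by exists M => _ [n _ <-]; rewrite /series /= big_mkord.
Qed.

Lemma summable_seq_cvg0 (R : realType) (a : nat -> R) :
  summable_seq a -> a @ \oo --> 0.
Proof. by move=> /summable_seq_cvg; exact: cvg_series_cvg_0. Qed.

Lemma summable_expr (R : realType) (r : R) :
  0 <= r < 1 -> summable_seq (fun t => r ^+ t).
Proof.
move=> /andP[r0 r1]; split=> [t|]; first exact: exprn_ge0.
have r1' : 0 < 1 - r by rewrite subr_gt0.
exists (1 - r)^-1 => n; rewrite -[leRHS]mul1r ler_pdivlMr //.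
have -> : (\sum_(t < n) r ^+ t) * (1 - r) = 1 - r ^+ n.
  elim: n => [|n IH]; first by rewrite big_ord0 mul0r expr0 subrr.
  by rewrite big_ord_recr /= mulrDl IH exprS; ring.
by rewrite lerBlDr lerDl exprn_ge0.
Qed.

(* Cauchy condensation. *)
Lemma summable_powR (R : realType) (p : R) :
  p < -1 -> summable_seq (fun t => t.+1%:R `^ p).
Proof.
move=> p1; split=> [t|]; first exact: powR_ge0.
(* The terms whose base [t.+1] runs from [2 ^ k] to [2 ^ k.+1 - 1] are [2 ^ k] in number and each at
   most the power [p] of [2 ^ k], so they add up to at most [r ^+ k]; here [r < 1] because
   [p + 1 < 0]. *)
pose r : R := 2 `^ (p + 1).
have r01 : 0 <= r < 1.
  rewrite powR_ge0 /= /r /powR pnatr_eq0 /= expR_lt1 nmulr_rlt0 ?ln_gt0 ?ltr1n //.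
  by lra.
have [_ [M rM]] := summable_expr r01.
exists M => n.
have pow_gt0 k : (0 < 2 ^ k)%N by rewrite expn_gt0.
have dyadic k : \sum_(t < (2 ^ k).-1) (t.+1%:R : R) `^ p <= \sum_(j < k) r ^+ j.
  elim: k => [|k IH]; first by rewrite !big_ord0.
  have k2 : (2 ^ k.+1).-1 = ((2 ^ k).-1 + 2 ^ k)%N.
    by rewrite expnS mul2n -addnn; case: (2 ^ k)%N (pow_gt0 k).
  rewrite k2 big_split_ord big_ord_recr /= lerD //.
  have -> : r ^+ k = \sum_(i < 2 ^ k) ((2 ^ k)%:R : R) `^ p.
    rewrite sumr_const card_ord -[RHS]mulr_natl natrX.
    rewrite -(powR_mulrn k (powR_ge0 _ _)) -(powR_mulrn k (ler0n _ 2)).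
    rewrite /r -!powRrM -powRD ?pnatr_eq0 ?implybT //.
    by congr (_ `^ _); ring.
  apply: ler_sum => i _; rewrite -[p]opprK !(powRN _ (- p)).
  rewrite lef_pV2 ?posrE ?powR_gt0 ?ltr0n ?expn_gt0 //.
  apply: ge0_ler_powR; rewrite ?nnegrE ?ler0n //; first lra.
  by rewrite ler_nat -[leqLHS](prednK (pow_gt0 k)) ltnS leq_addr.
apply: le_trans (rM n); apply: le_trans (dyadic n).
have n2 : (n <= (2 ^ n).-1)%N by rewrite -ltnS prednK ?expn_gt0 // ltn_expl.
rewrite -(subnKC n2) big_split_ord /= lerDl sumr_ge0 //.
Qed.

Lemma harmonic_sum_unbounded (R : realType) (M : R) :
  exists n, M < \sum_(t < n) (t.+1%:R)^-1.
Proof.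
apply: contrapT => noM; apply: (@dvg_harmonic R).
apply: summable_seq_cvg; split=> [t|]; first by rewrite invr_ge0.
exists M => n; rewrite leNgt; apply/negP => Mn; apply: noM; by exists n.
Qed.

(** If [h] stayed above [e] from time [m] on, the bound [B] on the weighted sums would cap the tail
    sums of [s] by [B / e], against their divergence. *)
Lemma divergent_weights_frequently_small (R : realType) (s h : nat -> R) :
  (forall t, 0 <= s t) -> (forall M, exists n, M < \sum_(t < n) s t) ->
  summable_seq (fun t => s t * h t) ->
  forall e, 0 < e -> forall m, exists2 t, (m <= t)%N & h t < e.
Proof.
move=> s0 sM [sh0 [B shB]] e e0 m; apply: contrapT => noh.
have hge t : (m <= t)%N -> e <= h t.
  by move=> mt; rewrite leNgt; apply/negP => ?; apply: noh; exists t.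
have [n] := sM (\sum_(t < m) s t + B / e).
have B0 : 0 <= B by have := shB 0%N; rewrite big_ord0.
have [nm|/ltnW mn] := leqP n m.
  rewrite ltNge => /negP; apply.
  rewrite (big_ord_widen _ s nm) big_mkcond /= -[leLHS]addr0 lerD //;
    last by rewrite divr_ge0 // ltW.
  by apply: ler_sum => i _; case: ifP.
rewrite -(subnKC mn) big_split_ord /= ltrD2l ltr_pdivrMr // ltNge => /negP; apply.
have := shB n; rewrite -[in X in X -> _](subnKC mn) big_split_ord /=.
apply: le_trans; rewrite -[leLHS]add0r lerD ?sumr_ge0 // mulr_suml.
apply: ler_sum => i _; rewrite ler_wpM2l // hge // leq_addr //.
Qed.

(** * Perturbed scalar recursions *)

(* The perturbed descent is made summable by [1 + b <= expR b]. *)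
Lemma robbins_siegmund (R : realType) (a b c : nat -> R) :
  (forall t, 0 <= a t) -> (forall t, 0 <= c t) -> summable_seq b ->
  (forall t, a t.+1 <= (1 + b t) * a t - c t) ->
  cvgn a /\ summable_seq c.
Proof.
move=> a0 c0 [b0 [B bB]] rec.
have abound n : a n <= expR (\sum_(t < n) b t) * a 0%N.
  elim: n => [|n IH]; first by rewrite big_ord0 expR0 mul1r.
  rewrite big_ord_recr /= addrC expRD -mulrA; apply: le_trans (rec n) _.
  rewrite lerBlDr -[leLHS]addr0 lerD // ler_pM ?addr_ge0 ?expR_ge1Dx //.
(* A uniform bound on [a], which turns the multiplicative perturbation into the summable additive
   term [b t * A]. *)
pose A := expR B * a 0%N.
have aA n : a n <= A.
  apply: le_trans (abound n) _.
  by rewrite ler_wpM2r // ler_expR.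
have rec' t : a t.+1 <= a t + b t * A - c t.
  apply: le_trans (rec t) _; rewrite lerD2r mulrDl mul1r lerD2l.
  by rewrite ler_wpM2l.
have csum n : a n + \sum_(t < n) c t <= a 0%N + (\sum_(t < n) b t) * A.
  elim: n => [|n IH]; first by rewrite !big_ord0 mul0r.
  by rewrite !big_ord_recr /= mulrDl; have := rec' n; lra.
have A0 : 0 <= A by rewrite mulr_ge0 // expR_ge0.
split; last first.
  split=> //; exists (a 0%N + B * A) => n.
  have := csum n; have := a0 n.
  have : (\sum_(t < n) b t) * A <= B * A by rewrite ler_wpM2r.
  lra.
(* Removing the accumulated perturbation leaves a nonincreasing sequence bounded below; adding the
   convergent series back gives the limit of [a]. *)
pose d n := a n - (\sum_(t < n) b t) * A.
have dcvg : cvgn d.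
  apply: nonincreasing_is_cvgn.
    apply/nonincreasing_seqP => n; rewrite /d big_ord_recr /= mulrDl.
    by have := rec' n; have := c0 n; lra.
  exists (- (B * A)) => _ [n _ <-]; rewrite /d.
  have : (\sum_(t < n) b t) * A <= B * A by rewrite ler_wpM2r.
  by have := a0 n; lra.
have -> : a = d \+ (A *: series b).
  apply/funext => n; rewrite -[RHS]/(d n + A * series b n).
  by rewrite /d /series /= big_mkord; ring.
by apply: is_cvgD => //; apply: is_cvgZr; apply: summable_seq_cvg; split=> //; exists B.
Qed.

(** Squaring the recursion keeps the factor [r] and costs only [1 / (1 - r)] on the input; summing
    over time, the contracted part is absorbed on the left and leaves the coefficient
    [1 - r > 0]. *)
Lemma summable_geometric_filter (R : realType) (r : R) (u s : nat -> R) :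
  0 <= r < 1 -> (forall t, 0 <= u t) -> (forall t, 0 <= s t) ->
  (forall t, u t.+1 <= r * u t + s t) ->
  summable_seq (fun t => s t ^+ 2) -> summable_seq (fun t => u t ^+ 2).
Proof.
move=> /andP[r0 r1] u0 s0 rec [_ [M sM]].
have r1' : 0 < 1 - r by rewrite subr_gt0.
split=> [t|]; first exact: sqr_ge0.
(* convexity of the square at the points [u t] and [s t / (1 - r)] *)
have rec2 t : u t.+1 ^+ 2 <= r * u t ^+ 2 + s t ^+ 2 / (1 - r).
  apply: le_trans (_ : (r * u t + s t) ^+ 2 <= _).
    by rewrite ler_sqr ?nnegrE ?addr_ge0 // mulr_ge0.
  have -> : r * u t ^+ 2 + s t ^+ 2 / (1 - r) =
     (r * u t + s t) ^+ 2 + r * (1 - r) * (u t - s t / (1 - r)) ^+ 2.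
    by field; rewrite gt_eqF.
  by rewrite lerDl mulr_ge0 ?sqr_ge0 // mulr_ge0 // ltW.
have inv n : (1 - r) * \sum_(t < n) u t ^+ 2 + u n ^+ 2 <=
    u 0%N ^+ 2 + (\sum_(t < n) s t ^+ 2) / (1 - r).
  elim: n => [|n IH]; first by rewrite !big_ord0 mulr0 mul0r; lra.
  by rewrite !big_ord_recr /= mulrDl mulrDr; have := rec2 n; lra.
exists ((u 0%N ^+ 2 + M / (1 - r)) / (1 - r)) => n.
rewrite ler_pdivlMr // mulrC.
have h : (\sum_(t < n) s t ^+ 2) / (1 - r) <= M / (1 - r).
  by rewrite ler_wpM2r // invr_ge0 ltW.
by have := inv n; have := sqr_ge0 (u n); lra.
Qed.

(** * Powers of a primitive stochastic matrix *)

Lemma row_stochasticX (R : realType) (N : nat) (P : 'M[R]_N) (t : nat) :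
  row_stochastic P -> row_stochastic (P ^+ t).
Proof.
move=> [P0 P1]; elim: t => [|t [IH0 IH1]].
  split=> [i j|i]; rewrite expr0.
    by rewrite mxE; case: (_ == _).
  under eq_bigr do rewrite mxE.
  rewrite (bigD1 i) //= eqxx big1 ?addr0 // => j ji.
  by rewrite eq_sym (negPf ji).
rewrite exprS; split=> [i j|i].
  by rewrite mxE sumr_ge0 // => k _; rewrite mulr_ge0.
under eq_bigr do rewrite mxE.
rewrite exchange_big /= -[RHS](P1 i); apply: eq_bigr => j _.
by rewrite -mulr_sumr IH1 mulr1.
Qed.

(** Doeblin minorization: the share [e] of each weight contributes a part independent of [p], and
    only the residual mass [1 - N%:R * e] averages values of the interval. Averages for different
    [p] thus share an interval shorter by that factor. *)
Lemma stochastic_average_itv (R : realType) (N : nat) (p v : 'I_N -> R)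
    (e a b : R) :
  \sum_j p j = 1 -> (forall j, e <= p j) -> (forall j, a <= v j <= b) ->
  \sum_j e * v j + (1 - N%:R * e) * a <= \sum_j p j * v j
    <= \sum_j e * v j + (1 - N%:R * e) * b.
Proof.
move=> p1 pe vab; set s := \sum_j e * v j.
have w0 j : 0 <= p j - e by rewrite subr_ge0.
have -> : \sum_j p j * v j = s + \sum_j (p j - e) * v j.
  by rewrite -big_split; apply: eq_bigr => j _ /=; ring.
have w1 : 1 - N%:R * e = \sum_j (p j - e).
  by rewrite sumrB p1 sumr_const card_ord mulr_natl.
rewrite !lerD2l w1 !mulr_suml; apply/andP; split; apply: ler_sum => j _.
  by rewrite ler_wpM2l //; case/andP: (vab j).
by rewrite ler_wpM2l //; case/andP: (vab j).
Qed.

Lemma le_addMexpr (R : realType) (a b C r : R) :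
  0 <= r < 1 -> (forall t, a <= b + C * r ^+ t) -> a <= b.
Proof.
move=> r01 ab; have [r0 r1] := andP r01.
have cv : (fun t => b + C * r ^+ t) @ \oo --> b + C * 0.
  apply: cvgD; first exact: cvg_cst.
  apply: cvgMr; apply: cvg_expr; by rewrite ger0_norm.
rewrite mulr0 addr0 in cv; rewrite -(cvg_lim _ cv) //.
apply: limr_ge; first by apply/cvg_ex; exists b.
by apply: nearW.
Qed.

(** The entries of [P ^+ t] applied to [v] lie in nested intervals, since a stochastic row only
    averages; by minorization each block of [T] steps shrinks the length by the factor [r]. *)
Lemma row_stochastic_mixing (R : realType) (N T : nat) (P : 'M[R]_N.+1) (e : R)
    (v : 'I_N.+1 -> R) :
  row_stochastic P -> (0 < T)%N -> 0 < e -> (forall i j, e <= (P ^+ T) i j) ->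
  let r := 1 - N.+1%:R * e in
  (forall j, 0 <= v j <= 1) ->
  exists l, forall t i, `|\sum_j (P ^+ t) i j * v j - l| <= r ^+ (t %/ T).
Proof.
move=> Pst T0 e0 Pe r v01.
pose y t i := \sum_j (P ^+ t) i j * v j.
have yS s t i : y (s + t)%N i = \sum_j (P ^+ s) i j * y t j.
  rewrite /y exprD; under eq_bigr do rewrite mxE mulr_suml.
  rewrite exchange_big /=; apply: eq_bigr => j _; rewrite mulr_sumr.
  by apply: eq_bigr => k _; rewrite mulrA.
have ylb s t a : (forall i, a <= y t i) -> forall i, a <= y (s + t)%N i.
  move=> ya i; have [Q0 Q1] := row_stochasticX s Pst.
  rewrite yS -[a]mul1r -(Q1 i) mulr_suml; apply: ler_sum => j _.
  by rewrite ler_wpM2l.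
have yub s t b : (forall i, y t i <= b) -> forall i, y (s + t)%N i <= b.
  move=> yb i; have [Q0 Q1] := row_stochasticX s Pst.
  rewrite yS -[b]mul1r -(Q1 i) mulr_suml; apply: ler_sum => j _.
  by rewrite ler_wpM2l.
have ymono s t a b : (forall i, a <= y t i <= b) ->
    forall i, a <= y (s + t)%N i <= b.
  move=> yab i; apply/andP; split.
    by apply: (ylb) => j; case/andP: (yab j).
  by apply: (yub) => j; case/andP: (yab j).
have yitv k : exists a, forall i, a <= y (k * T)%N i <= a + r ^+ k.
  elim: k => [|k [a IH]].
    exists 0 => i; rewrite mul0n expr0 add0r.
    have [Q0 Q1] := row_stochasticX 0 Pst.
    have := stochastic_average_itv (Q1 i) (Q0 i) v01.
    rewrite big1 => [|j _]; last by rewrite mul0r.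
    by rewrite !(mulr0, subr0, mul1r, add0r).
  have [_ Q1] := row_stochasticX T Pst.
  (* This lower endpoint serves all rows [i] at once, because the minorized share weights every
     index by the same [e]. *)
  exists (\sum_j e * y (k * T)%N j + r * a) => i.
  have := stochastic_average_itv (Q1 i) (Pe i) IH.
  by rewrite mulSn yS -/r mulrDr exprS addrA.
have yitvt t : exists a, forall s i, a <= y (s + t)%N i <= a + r ^+ (t %/ T).
  have [a ha] := yitv (t %/ T)%N; exists a => s i; apply: (ymono) => {}i.
  by rewrite [in y _](divn_eq t T) addnC; apply: (ymono).
(* The limit is the supremum of the lower bounds valid at some time; comparison at the common time
   [t + s] shows that every upper bound dominates it. *)
pose A := [set a : R | exists t, forall i, a <= y t i].
have supA t b : (forall i, y t i <= b) -> ubound A b.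
  move=> yb a [s ya].
  apply: le_trans (_ : y (t + s)%N ord0 <= b); first exact: (ylb).
  by rewrite addnC; apply: (yub).
exists (sup A) => t i.
have [a /(_ 0%N) ha] := yitvt t.
have aA : A a by exists t => j; case/andP: (ha j).
have ub : ubound A (a + r ^+ (t %/ T)).
  by apply: (supA t) => j; case/andP: (ha j).
have la : a <= sup A by apply: ub_le_sup => //; eexists; exact: ub.
have lb : sup A <= a + r ^+ (t %/ T) by apply: ge_sup => //; exists a.
by have := ha i; rewrite -/(y t i) ler_distl => /andP[? ?]; apply/andP; split; lra.
Qed.

Lemma bernoulli_expr (R : realType) (x : R) (n : nat) :
  0 <= x <= 1 -> 1 - n%:R * x <= (1 - x) ^+ n.
Proof.
move=> /andP[x0 x1]; elim: n => [|n IH]; first by rewrite mul0r subr0 expr0.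
have y0 : 0 <= 1 - x by rewrite subr_ge0.
rewrite exprS; apply: le_trans (ler_wpM2l y0 IH).
rewrite -natr1; have : 0 <= n%:R * x ^+ 2 by rewrite mulr_ge0 ?sqr_ge0.
by rewrite -subr_ge0; congr (0 <= _); ring.
Qed.

(** Converts a contraction per block of [T] steps into a rate per step: with [x = e / T], Bernoulli
    gives [1 - e <= (1 - x) ^+ T], and the constant [(1 - x) ^- T] pays for the incomplete last
    block. *)
Lemma expr_divn_le (R : realType) (e : R) (T : nat) :
  (0 < T)%N -> 0 < e < 1 ->
  exists C r, [/\ 0 <= C, 0 <= r < 1 &
    forall t, (1 - e) ^+ (t %/ T) <= C * r ^+ t].
Proof.
move=> T0 /andP[e0 e1].
have TR : 0 < T%:R :> R by rewrite ltr0n.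
pose x := e / T%:R.
have x0 : 0 < x by rewrite divr_gt0.
have xe : x <= e by rewrite ler_pdivrMr // ler_peMr ?ler1n // ltW.
have r0 : 0 < 1 - x by lra.
exists ((1 - x) ^- T), (1 - x); split; [by rewrite invr_ge0 exprn_ge0 // ltW| |].
  by apply/andP; split; lra.
move=> t; rewrite mulrC ler_pdivlMr ?exprn_gt0 //.
have h : (1 - e) ^+ (t %/ T) <= (1 - x) ^+ (t %/ T * T).
  rewrite mulnC exprM; apply: lerXn2r; rewrite ?nnegrE; first lra.
    by rewrite exprn_ge0 // ltW.
  rewrite -[e in leLHS](divfK (lt0r_neq0 TR)) -/x mulrC.
  by apply: bernoulli_expr; apply/andP; split; lra.
apply: le_trans (_ : (1 - x) ^+ (t %/ T * T) * (1 - x) ^+ (t %% T) <= _); last first.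
  by rewrite -exprD -divn_eq.
apply: ler_pM => //; first by rewrite exprn_ge0 //; lra.
  by rewrite exprn_ge0 // ltW.
by apply: ler_wiXn2l; [lra | lra | exact: ltnW (ltn_pmod _ _)].
Qed.

(** Mixing applied to each indicator vector gives the limit of one column; positivity, total mass
    and stationarity of [p] are then read off the powers by letting [t] grow. *)
Lemma primitive_stochastic_limit (R : realType) (N : nat) (P : 'M[R]_N.+1) :
  row_stochastic P -> primitive_mx P ->
  exists (p : 'I_N.+1 -> R) (C r : R),
    [/\ 0 <= C, 0 <= r < 1,
        (forall j, 0 < p j) /\ \sum_j p j = 1,
        forall k, \sum_j p j * P j k = p k &
        forall t i j, `|(P ^+ t) i j - p j| <= C * r ^+ t].
Proof.
move=> Pst [P0 [T T0 PT]].
pose m := \big[Order.min/1]_(ij : 'I_N.+1 * 'I_N.+1) (P ^+ T) ij.1 ij.2.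
have m0 : 0 < m by apply: lt_bigmin => // ij _; exact: PT.
have Pm i j : m <= (P ^+ T) i j.
    exact: (@bigmin_le _ _ _ 1 (i, j) (fun ij => (P ^+ T) ij.1 ij.2)).
have Nm : N.+1%:R * m <= 1.
  have [_ Q1] := row_stochasticX T Pst.
  by rewrite -[leRHS](Q1 ord0) mulr_natl -[N.+1 in leLHS]card_ord -sumr_const ler_sum.
have N0 : 0 < N.+1%:R :> R by rewrite ltr0n.
have Nm0 : 0 < N.+1%:R * m by rewrite mulr_gt0.
(* Half the minimum is used because [N.+1%:R * m] may equal 1, while the rate needs a number
   strictly below 1. *)
have [|C [r [C0 r01 Cr]]] := @expr_divn_le R (N.+1%:R * (m / 2)) T T0.
  by rewrite mulrA; apply/andP; split; lra.
have lim k : exists l, forall t i, `|(P ^+ t) i k - l| <= C * r ^+ t.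
  have [||j|l hl] := @row_stochastic_mixing R N T P (m / 2)
      (fun j => (j == k)%:R) Pst T0.
  - lra.
  - by move=> i j; have := Pm i j; lra.
  - by case: (j == k); rewrite ?ler01 ?lexx.
  exists l => t i; apply: le_trans (Cr t); apply: le_trans (hl t i).
  rewrite (bigD1 k) //= eqxx mulr1 big1 ?addr0 // => j /negPf ->.
  by rewrite mulr0.
have [p hp] := choice lim.
have near_eq (a b D : R) : (forall t, `|a - b| <= D * r ^+ t) -> a = b.
  move=> ab; apply: subr0_eq; apply/eqP; rewrite -normr_le0.
  by apply: (@le_addMexpr _ _ 0 D r) => // t; rewrite add0r.
have hp' t i j : `|(P ^+ t) i j - p j| <= C * r ^+ t by exact: hp.
exists p, C, r; split=> //; first split.
- move=> j; apply: lt_le_trans m0 _; apply: (@le_addMexpr _ _ _ C r) => // t.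
  (* Entries of [P ^+ (t + T)] are averages of entries of [P ^+ T], so the lower bound [m] persists
     in the limit. *)
  have mt : m <= (P ^+ (t + T)) ord0 j.
    have [Q0 Q1] := row_stochasticX t Pst.
    rewrite exprD mxE -[m]mul1r -(Q1 ord0) mulr_suml; apply: ler_sum => k _.
    by rewrite ler_wpM2l.
  apply: le_trans mt _; have := hp' (t + T)%N ord0 j.
  have : C * r ^+ (t + T) <= C * r ^+ t.
    have /andP[? ?] := r01.
    by rewrite ler_wpM2l // ler_wiXn2l ?leq_addr // ltW.
  by rewrite ler_distl => ? /andP[? ?]; lra.
- apply: (near_eq _ _ (N.+1%:R * C)) => t.
  have [_ Q1] := row_stochasticX t Pst.
  rewrite -[X in _ - X](Q1 ord0) -sumrB; apply: le_trans (ler_norm_sum _ _ _) _.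
  rewrite -mulrA mulr_natl -[N.+1 in leRHS]card_ord -sumr_const; apply: ler_sum => j _.
  by rewrite distrC.
- move=> k; apply: (near_eq _ _ (N.+1%:R * C + C)) => t.
  (* Row [ord0] of [P ^+ t] is close to [p], and its product with [P] is the same row of
     [P ^+ t.+1], again close to [p]. *)
  have -> : \sum_j p j * P j k - p k =
     \sum_j (p j - (P ^+ t) ord0 j) * P j k + ((P ^+ t.+1) ord0 k - p k).
    rewrite exprSr mxE.
    rewrite [X in _ + (X - _)](eq_bigr (fun j => (P ^+ t) ord0 j * P j k)) //.
    rewrite addrA -big_split; congr (_ - _); apply: eq_bigr => j _ /=; ring.
  rewrite mulrDl; apply: le_trans (ler_normD _ _) _; apply: lerD; last first.
    apply: le_trans (hp' _ _ _) _; have /andP[? ?] := r01.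
    by rewrite ler_wpM2l // ler_wiXn2l // ltW.
  apply: le_trans (ler_norm_sum _ _ _) _.
  rewrite -mulrA mulr_natl -[N.+1 in leRHS]card_ord -sumr_const; apply: ler_sum => j _.
  rewrite normrM -[leRHS]mulr1 ler_pM //; first by rewrite distrC.
  have [Q0 Q1] := Pst; rewrite ger0_norm // -(Q1 j) (bigD1 k) //= lerDl.
  by rewrite sumr_ge0.
Qed.

(* Proving the bound for all [k] at once absorbs the convolution of the
   perturbations with the powers of [P]. *)
Lemma consensus_deviation (R : realType) (N : nat) (P : 'M[R]_N) (p : 'I_N -> R)
    (C r : R) (y e : 'I_N -> nat -> R) (u : nat -> R) :
  0 <= C -> 0 <= r -> (forall k, \sum_j p j * P j k = p k) ->
  (forall t i j, `|(P ^+ t) i j - p j| <= C * r ^+ t) ->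
  (forall i t, y i t.+1 = \sum_j P i j * y j t - e i t) ->
  \sum_j `|y j 0%N| <= u 0%N ->
  (forall t, r * u t + \sum_j `|e j t| <= u t.+1) ->
  forall t k i, `|\sum_j ((P ^+ k) i j - p j) * y j t| <= C * r ^+ k * u t.
Proof.
move=> C0 r0 pP Pp yS y0 uS.
have dev k i (w : 'I_N -> R) :
    `|\sum_j ((P ^+ k) i j - p j) * w j| <= C * r ^+ k * \sum_j `|w j|.
  apply: le_trans (ler_norm_sum _ _ _) _; rewrite mulr_sumr; apply: ler_sum => j _.
  by rewrite normrM ler_wpM2r.
elim=> [|t IH] k i.
  by apply: le_trans (dev _ _ _) _; rewrite ler_wpM2l // mulr_ge0 ?exprn_ge0.
(* Stationarity of [p] moves the factor [P] of the recursion into the power, so the induction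
   hypothesis is needed at [k.+1]. *)
have -> : \sum_j ((P ^+ k) i j - p j) * y j t.+1 =
    \sum_j ((P ^+ k.+1) i j - p j) * y j t - \sum_j ((P ^+ k) i j - p j) * e j t.
  rewrite [in LHS](eq_bigr (fun j => \sum_l ((P ^+ k) i j - p j) * P j l * y l t
      - ((P ^+ k) i j - p j) * e j t)); last first.
    by move=> j _; rewrite yS mulrBr mulr_sumr; under eq_bigr do rewrite mulrA.
  rewrite sumrB exchange_big /=; congr (_ - _); apply: eq_bigr => l _.
  rewrite -mulr_suml; congr (_ * _); under eq_bigr do rewrite mulrBl.
  by rewrite sumrB pP exprSr mxE.
apply: le_trans (ler_normB _ _) _.
apply: le_trans (lerD (IH k.+1 i) (dev k i (fun j => e j t))) _.
have -> : C * r ^+ k.+1 * u t = C * r ^+ k * (r * u t) by rewrite exprSr; ring.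
by rewrite -mulrDr ler_wpM2l // mulr_ge0 ?exprn_ge0.
Qed.

(** * Convexity, dot products and existence of subgradients *)

Lemma convex_functionP (R : realType) (d : nat) (f : 'rV[R]_d -> R) :
  convex_function [set: 'rV[R]_d] f ->
  forall t x y, 0 <= t <= 1 ->
    f (t *: x + (1 - t) *: y) <= t * f x + (1 - t) * f y.
Proof.
move=> cf t x y /andP[t0 t1].
by have := cf (Itv01 t0 t1) x y (mem_setT _) (mem_setT _).
Qed.

Lemma dotvDl (R : realType) (d : nat) (u v w : 'rV[R]_d) :
  dotv (u + v) w = dotv u w + dotv v w.
Proof. by rewrite -big_split; apply: eq_bigr => l _; rewrite !mxE mulrDl. Qed.

Lemma dotvZl (R : realType) (d : nat) (k : R) (u w : 'rV[R]_d) :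
  dotv (k *: u) w = k * dotv u w.
Proof. by rewrite mulr_sumr; apply: eq_bigr => l _; rewrite !mxE mulrA. Qed.

Lemma dotvC (R : realType) (d : nat) (u v : 'rV[R]_d) : dotv u v = dotv v u.
Proof. by apply: eq_bigr => l _; rewrite mulrC. Qed.

Lemma dotvDr (R : realType) (d : nat) (u v w : 'rV[R]_d) :
  dotv u (v + w) = dotv u v + dotv u w.
Proof. by rewrite dotvC dotvDl !(dotvC u). Qed.

Lemma dotvZr (R : realType) (d : nat) (k : R) (u w : 'rV[R]_d) :
  dotv u (k *: w) = k * dotv u w.
Proof. by rewrite dotvC dotvZl dotvC. Qed.

Lemma dotv_delta (R : realType) (d : nat) (k : 'I_d) (w : 'rV[R]_d) :
  dotv (delta_mx 0 k) w = w 0 k.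
Proof.
rewrite /dotv (bigD1 k) //= mxE !eqxx mul1r big1 ?addr0 // => l /negPf lk.
by rewrite mxE lk andbF mul0r.
Qed.

Lemma dotv_suml (R : realType) (d : nat) (I : finType) (u : I -> 'rV[R]_d)
    (w : 'rV[R]_d) : dotv (\sum_i u i) w = \sum_i dotv (u i) w.
Proof.
rewrite /dotv exchange_big; apply: eq_bigr => l _ /=.
by rewrite summxE mulr_suml.
Qed.

(* A Hahn-Banach argument, one coordinate at a time. *)
Lemma convex_subgradient (R : realType) (d : nat) (f : 'rV[R]_d -> R) :
  convex_function [set: 'rV[R]_d] f -> forall z, subdifferential f z !=set0.
Proof.
move=> /convex_functionP cf z.
(* [g] has to support [f] only along directions carried by the first [k] coordinates; the induction
   enlarges this subspace by one basis vector. *)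
suff H k : (k <= d)%N -> exists g, forall v : 'rV[R]_d,
    (forall l : 'I_d, (k <= l)%N -> v 0 l = 0) -> f z + dotv g v <= f (z + v).
  have [g gP] := H d (leqnn d).
  exists g => y /=; have := gP (y - z); rewrite subrKC => -> // l.
  by rewrite leqNgt ltn_ord.
elim: k => [_|k IH kd].
  exists 0 => v v0; have -> : v = 0 by apply/rowP => l; rewrite v0 // mxE.
  by rewrite addr0 -(scale0r 0) dotvZl mul0r addr0.
have [g gP] := IH (ltnW kd).
pose V := [set v : 'rV[R]_d | forall l : 'I_d, (k <= l)%N -> v 0 l = 0].
pose e : 'rV[R]_d := delta_mx 0 (Ordinal kd).
(* Backward slopes along [e] never exceed forward ones: the convex combination with weights
   [t / (s + t)] and [s / (s + t)] cancels [e] and leaves a direction in [V], where [g] already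
   supports [f]. *)
have sep v w (s t : R) : V v -> V w -> 0 < s -> 0 < t ->
    (dotv g v + f z - f (z + v - s *: e)) / s <=
    (f (z + w + t *: e) - f z - dotv g w) / t.
  move=> Vv Vw s0 t0; have st0 : 0 < s + t by rewrite addr_gt0.
  rewrite ler_pdivrMr // mulrAC ler_pdivlMr //.
  have c01 : 0 <= t / (s + t) <= 1.
    by rewrite divr_ge0 ?(ltW t0, ltW st0) //= ler_pdivrMr // mul1r lerDr ltW.
  have := cf _ (z + v - s *: e) (z + w + t *: e) c01.
  have -> : t / (s + t) *: (z + v - s *: e) + (1 - t / (s + t)) *: (z + w + t *: e)
      = z + (t / (s + t) *: v + s / (s + t) *: w).
    apply/rowP => l; rewrite !mxE; field; rewrite gt_eqF //.
  move=> cvx; have := gP (t / (s + t) *: v + s / (s + t) *: w) _.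
  rewrite dotvDr !dotvZr => /(_ _)/le_trans/(_ cvx) H.
  have {H} : f z + (t / (s + t) * dotv g v + s / (s + t) * dotv g w) <=
      t / (s + t) * f (z + v - s *: e) + (1 - t / (s + t)) * f (z + w + t *: e).
    by apply: H => l kl; rewrite !mxE Vv // Vw // !mulr0 addr0.
  rewrite -(ler_pM2r st0).
  set A := f (z + v - _); set B := f (z + w + _).
  have -> : (f z + (t / (s + t) * dotv g v + s / (s + t) * dotv g w)) * (s + t) =
    f z * (s + t) + t * dotv g v + s * dotv g w by field; rewrite gt_eqF.
  have -> : (t / (s + t) * A + (1 - t / (s + t)) * B) * (s + t) = t * A + s * B.
    by field; rewrite gt_eqF.
  by nra.
pose A := [set a : R | exists v s, [/\ V v, 0 < s &
    a = (dotv g v + f z - f (z + v - s *: e)) / s]].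
have V0 : V 0 by move=> l _; rewrite mxE.
have ubA w t : V w -> 0 < t -> ubound A ((f (z + w + t *: e) - f z - dotv g w) / t).
  by move=> Vw t0 _ [v [s [Vv s0 ->]]]; exact: sep.
have A0 : A !=set0 by eexists; exists 0, 1.
have lowA v s : V v -> 0 < s ->
    (dotv g v + f z - f (z + v - s *: e)) / s <= sup A.
  move=> Vv s0; apply: ub_le_sup; last by exists v, s.
  by eexists; apply: (ubA 0 1).
have upA w t : V w -> 0 < t ->
    sup A <= (f (z + w + t *: e) - f z - dotv g w) / t.
  by move=> Vw t0; apply: ge_sup => //; exact: ubA.
(* The correction replaces coordinate [k] of [g] by [sup A], which separates the backward slopes
   from the forward ones. *)
exists (g + (sup A - g 0 (Ordinal kd)) *: e) => y yk.
pose s := y 0 (Ordinal kd); pose v := y - s *: e.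
have ve : v 0 (Ordinal kd) = 0 by rewrite !mxE !eqxx mulr1 subrr.
have Vv : V v.
  move=> l; rewrite leq_eqVlt => /orP[/eqP kl|kl].
    by have -> : l = Ordinal kd by apply: val_inj.
  rewrite !mxE yk //= -(inj_eq val_inj) /= gtn_eqF //.
  by rewrite mulr0 subr0.
have -> : y = v + s *: e by rewrite subrK.
clearbody s v.
have -> : dotv (g + (sup A - g 0 (Ordinal kd)) *: e) (v + s *: e) =
    dotv g v + s * sup A.
  rewrite dotvDl dotvZl !dotvDr !dotvZr (dotvC g e) !dotv_delta ve.
  by rewrite mxE !eqxx /=; ring.
have [s0|s0|->] := ltgtP s 0; last first.
- by rewrite mul0r scale0r !addr0; apply: gP.
- have := upA v s Vv s0; rewrite ler_pdivlMr // (addrA z); lra.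
- have ns0 : 0 < - s by rewrite oppr_gt0.
  have := lowA v (- s) Vv ns0; rewrite ler_pdivrMr // scaleNr opprK (addrA z); lra.
Qed.

(** * Norm comparisons and bounded subgradients *)

Lemma normr_dotv_le (R : realType) (d : nat) (u v : 'rV[R]_d) :
  `|dotv u v| <= norm1 u * norm1 v.
Proof.
apply: le_trans (ler_norm_sum _ _ _) _; rewrite mulr_suml; apply: ler_sum => l _.
rewrite normrM ler_wpM2l // /norm1 (bigD1 l) //= lerDl sumr_ge0 //.
Qed.

Lemma norm1_ge0 (R : realType) (d : nat) (u : 'rV[R]_d) : 0 <= norm1 u.
Proof. exact: sumr_ge0. Qed.

Lemma norm1D (R : realType) (d : nat) (u v : 'rV[R]_d) :
  norm1 (u + v) <= norm1 u + norm1 v.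
Proof.
by rewrite -big_split; apply: ler_sum => l _; rewrite mxE ler_normD.
Qed.

Lemma norm1Z (R : realType) (d : nat) (k : R) (u : 'rV[R]_d) :
  norm1 (k *: u) = `|k| * norm1 u.
Proof. by rewrite mulr_sumr; apply: eq_bigr => l _; rewrite mxE normrM. Qed.

Lemma norm1N (R : realType) (d : nat) (u : 'rV[R]_d) : norm1 (- u) = norm1 u.
Proof. by rewrite -scaleN1r norm1Z normrN1 mul1r. Qed.

Lemma norm1_sum (R : realType) (d : nat) (I : finType) (u : I -> 'rV[R]_d) :
  norm1 (\sum_i u i) <= \sum_i norm1 (u i).
Proof.
rewrite /norm1 exchange_big; apply: ler_sum => l _ /=.
by rewrite summxE ler_norm_sum.
Qed.

Lemma mx_norm_le_norm1 (R : realType) (d : nat) (u : 'rV[R]_d) : `|u| <= norm1 u.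
Proof.
rewrite [leLHS]/Num.norm /= mx_normrE; apply: bigmax_le; first exact: norm1_ge0.
move=> [i l] _ /=; rewrite (ord1 i) /norm1 (bigD1 l) //= lerDl sumr_ge0 //.
Qed.

Lemma norm1_le_mx_norm (R : realType) (d : nat) (u : 'rV[R]_d) :
  norm1 u <= d%:R * `|u|.
Proof.
have -> : d%:R * `|u| = \sum_(l < d) `|u| by rewrite sumr_const card_ord mulr_natl.
apply: ler_sum => l _; rewrite [leRHS]/Num.norm /= mx_normrE.
exact: (@le_bigmax _ _ _ 0 (fun ij => `|u ij.1 ij.2|) (0, l)).
Qed.

Lemma sqr_coord_le_dotv (R : realType) (d : nat) (u : 'rV[R]_d) (l : 'I_d) :
  u 0 l ^+ 2 <= dotv u u.
Proof.
rewrite /dotv (bigD1 l) //= -expr2 lerDl sumr_ge0 // => k _.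
by rewrite -expr2 sqr_ge0.
Qed.

Lemma norm1_le_dotv (R : realType) (d : nat) (u : 'rV[R]_d) (e : R) :
  0 <= e -> dotv u u <= e ^+ 2 -> norm1 u <= d%:R * e.
Proof.
move=> e0 ue.
have -> : d%:R * e = \sum_(l < d) e by rewrite sumr_const card_ord mulr_natl.
apply: ler_sum => l _; rewrite -ler_sqr ?nnegrE // real_normK ?num_real //.
exact: le_trans (sqr_coord_le_dotv u l) ue.
Qed.

Lemma subgradient_sup_bound (R : realType) (d : nat) (I : finType)
    (f : I -> 'rV[R]_d -> R) :
  (forall i, (subgradient_sup (f i) < +oo)%E) ->
  exists2 L, 0 <= L & forall i z g, subdifferential (f i) z g -> norm1 g <= L.
Proof.
move=> fL.
have /choice[L LP] i : exists L : R,
    forall z g, subdifferential (f i) z g -> norm1 g <= L.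
  have H z g : subdifferential (f i) z g -> ((norm1 g)%:E <= subgradient_sup (f i))%E.
    move=> gz; pose S := [set (norm1 h)%:E | h in subdifferential (f i) z].
    apply: le_trans (_ : (ereal_sup S <= _)%E).
      by apply: ereal_sup_ubound; exists g.
    by apply: ereal_sup_ubound; exists z.
  case: (subgradient_sup (f i)) (fL i) H => [r _ H|//|_ H].
    by exists r => z g /H; rewrite lee_fin.
  by exists 0 => z g /H; rewrite leeNy_eq.
exists (\sum_i `|L i|); first exact: sumr_ge0.
move=> i z g /LP /le_trans; apply; apply: le_trans (ler_norm _) _.
by rewrite (bigD1 i) //= lerDl sumr_ge0.
Qed.

(** A subgradient at [x], which exists by convexity, bounds the drop from [f x] to [f y] by its
    pairing with [x - y]. *)
Lemma subgradient_lipschitz (R : realType) (d : nat) (f : 'rV[R]_d -> R) (L : R) :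
  convex_function [set: 'rV[R]_d] f ->
  (forall z g, subdifferential f z g -> norm1 g <= L) ->
  forall x y, f x - f y <= L * norm1 (x - y).
Proof.
move=> cf fL x y; have [g gx] := convex_subgradient cf x.
have := gx y; have := normr_dotv_le g (y - x); rewrite -(opprB y x) norm1N.
rewrite ler_norml => /andP[h _].
have : norm1 g * norm1 (y - x) <= L * norm1 (y - x).
  by rewrite ler_wpM2r ?norm1_ge0 //; exact: fL gx.
lra.
Qed.

(** * Products, limits and cluster points of sequences *)

Lemma summable_seqM (R : realType) (a b : nat -> R) :
  (forall t, 0 <= a t) -> (forall t, 0 <= b t) ->
  summable_seq (fun t => a t ^+ 2) -> summable_seq (fun t => b t ^+ 2) ->
  summable_seq (fun t => a t * b t).
Proof.
move=> a0 b0 sa sb; apply: summable_seq_le (summable_seqD sa sb) => t.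
rewrite mulr_ge0 //=; have := sqr_ge0 (a t - b t); have := mulr_ge0 (a0 t) (b0 t).
by rewrite sqrrB mulr2n; lra.
Qed.

Lemma summable_seqS (R : realType) (a : nat -> R) :
  0 <= a 0%N -> summable_seq (fun t => a t.+1) -> summable_seq a.
Proof.
move=> a0 [aS [M aM]]; split=> [[|t]//|].
have M0 : 0 <= M by have := aM 0%N; rewrite big_ord0.
exists (a 0%N + M) => -[|n]; first by rewrite big_ord0 addr_ge0.
by rewrite big_ord_recl lerD2l.
Qed.

Lemma inv_seq_bounded (R : realType) (w : nat -> R) (l : R) :
  0 < l -> w @ \oo --> l -> exists Z, forall t, (w t)^-1 <= Z.
Proof.
move=> l0 wl.
have /cvg_seq_bounded [M [_ MP]] : cvgn (fun t => (w t)^-1).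
  by apply/cvg_ex; exists l^-1; apply: cvgV => //; rewrite gt_eqF.
exists (M + 1) => t; apply: le_trans (ler_norm _) _.
by apply: (MP (M + 1)) => //; rewrite ltrDl.
Qed.

Lemma cvg_exprM (R : realType) (w : nat -> R) (l C r : R) :
  0 <= r < 1 -> (forall t, `|w t - l| <= C * r ^+ t) -> w @ \oo --> l.
Proof.
move=> /andP[r0 r1] wl.
have C0 : (fun t => C * r ^+ t) @ \oo --> 0.
  rewrite -(mulr0 C); apply: cvgMr; apply: cvg_expr; by rewrite ger0_norm.
apply/cvgrPdist_lt => e e0; have /cvgrPdist_lt/(_ e e0) := C0.
apply: filterS => t; rewrite sub0r normrN distrC.
by move/(le_lt_trans (ler_norm _)); apply: le_lt_trans.
Qed.

Lemma cvg_frequently_small (R : realType) (a : nat -> R) :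
  (forall t, 0 <= a t) -> cvgn a ->
  (forall e, 0 < e -> forall m, exists2 t, (m <= t)%N & a t < e) ->
  a @ \oo --> 0.
Proof.
move=> a0 ca small; suff <- : limn a = 0 by [].
apply/eqP; rewrite eq_le; apply/andP; split; last first.
  by apply: limr_ge => //; apply: nearW.
rewrite leNgt; apply/negP => l0.
have l2 : 0 < limn a / 2 by rewrite divr_gt0.
have /cvgrPdist_lt/(_ _ l2) [m _ mP] := ca.
have [t mt at_small] := small _ l2 m.
by have := mP t mt; rewrite ltr_norml => /andP[_]; move: at_small; lra.
Qed.

Lemma bounded_rV_cluster (R : realType) (d : nat) (v : nat -> 'rV[R]_d) (M : R) :
  (forall k, `|v k| <= M) ->
  exists y, forall e, 0 < e -> forall m, exists2 k, (m <= k)%N & `|y - v k| < e.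
Proof.
move=> vM; pose B := [set w : 'rV[R]_d | `|w| <= M].
have cB : compact B.
  apply: bounded_closed_compact.
    exists M; split; first exact: num_real.
    by move=> K MK w /= /le_trans; apply; exact: ltW.
  by apply: (@closed_comp _ _ _ [set s : R | s <= M]);
    [move=> w _; exact: norm_continuous | exact: closed_le].
have FB : \forall k \near \oo, B (v k) by apply: nearW => k; exact: vM.
have [y [_ cy]] := cB (v @ \oo) _ FB; exists y => e e0 m.
have := cy (v @` [set k | (m <= k)%N]) (ball y e).
case; [by exists m => // k mk; exists k | exact: nbhsx_ballx |].
by move=> _ [[k mk <-]]; rewrite -ball_normE /= => yk; exists k.
Qed.

(** * Weights as matrix powers, and one descent step *)

Lemma push_sum_weights (R : realType) (N : nat) (P : 'M[R]_N)
    (z : 'I_N -> nat -> 'rV[R]_N) :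
  (forall i, z i 0%N = delta_mx 0 i) ->
  (forall i t, z i t.+1 = \sum_j P i j *: z j t) ->
  forall t i k, z i t 0 k = (P ^+ t) i k.
Proof.
move=> z0 zS; elim=> [|t IH] i k.
  by rewrite z0 expr0 !mxE eqxx /= eq_sym.
rewrite zS exprS summxE mxE; apply: eq_bigr => j _.
by rewrite mxE IH.
Qed.

(** Expand the square: the cross term yields the objective gap, the quadratic term the squared step.
    The losses come from [D], since subgradients are taken away from [m], and from [om], since the
    weights differ from 1. *)
Lemma sqdist_subgradient_step (R : realType) (d : nat) (I : finType)
    (f : I -> 'rV[R]_d -> R) (x g : I -> 'rV[R]_d) (m y : 'rV[R]_d)
    (w : I -> R) (L D W om s : R) (m' : 'rV[R]_d) :
  (forall i u v, f i u - f i v <= L * norm1 (u - v)) ->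
  (forall i, subdifferential (f i) (x i) (g i)) ->
  (forall i, norm1 (g i) <= L) -> (forall i, norm1 (x i - m) <= D) ->
  (forall i, `|w i| <= W) -> (forall i, `|w i - 1| <= om) ->
  0 <= L -> 0 <= W -> 0 <= s -> m' = m - s *: \sum_i w i *: g i ->
  dotv (m' - y) (m' - y) <= dotv (m - y) (m - y)
    - 2 * s * (\sum_i f i m - \sum_i f i y)
    + 2 * s * (#|I|%:R * L * (2 * D + om * norm1 (m - y)))
    + s ^+ 2 * (#|I|%:R * W * L) ^+ 2.
Proof.
move=> fL gsub gL xD wW wom L0 W0 s0 ->; set n : R := #|I|%:R.
set G := \sum_i w i *: g i; set b := m - y.
have -> : m - s *: G - y = b - s *: G by rewrite /b addrAC.
have GW : norm1 G <= n * W * L.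
  apply: le_trans (norm1_sum _) _.
  have -> : n * W * L = \sum_(i : I) W * L.
    by rewrite sumr_const -[RHS]mulr_natl mulrA.
  by apply: ler_sum => i _; rewrite norm1Z ler_pM ?norm1_ge0.
have GG : dotv G G <= (n * W * L) ^+ 2.
  apply: le_trans (ler_norm _) _; apply: le_trans (normr_dotv_le _ _) _.
  by rewrite expr2 ler_pM ?norm1_ge0.
have Gb : \sum_i f i m - \sum_i f i y - n * L * (2 * D + om * norm1 b) <= dotv G b.
  rewrite /G dotv_suml.
  have -> : n * L * (2 * D + om * norm1 b) =
      \sum_(i : I) (L * (2 * D + om * norm1 b)).
    by rewrite sumr_const -[RHS]mulr_natl mulrA.
  rewrite -!sumrB; apply: ler_sum => i _.
  (* Weight error, displacement from [x i] to [m], and the subgradient inequality at [x i]. The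
     displacement costs [L * D] here and once more when [f i (x i)] is replaced by [f i m], hence
     the [2 * D]. *)
  have -> : dotv (w i *: g i) b = (w i - 1) * dotv (g i) b +
      dotv (g i) (m - x i) - dotv (g i) (y - x i).
    have -> : b = (m - x i) + (-1) *: (y - x i) by rewrite scaleN1r opprB subrKA.
    by rewrite dotvZl dotvDr !dotvZr; ring.
  have h1 := gsub i y; rewrite /= in h1.
  have h2 : f i m - f i (x i) <= L * D.
    apply: le_trans (fL _ _ _) _; rewrite ler_wpM2l // -norm1N opprB; exact: xD.
  have h3 : - (L * D) <= dotv (g i) (m - x i).
    apply: le_trans (_ : - (norm1 (g i) * norm1 (m - x i)) <= _).
      rewrite lerN2 ler_pM ?norm1_ge0 // -norm1N opprB; exact: xD.
    by have := normr_dotv_le (g i) (m - x i); rewrite ler_norml => /andP[].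
  have h4 : - (L * (om * norm1 b)) <= (w i - 1) * dotv (g i) b.
    have : `|(w i - 1) * dotv (g i) b| <= om * (L * norm1 b).
      rewrite normrM ler_pM //; apply: le_trans (normr_dotv_le _ _) _.
      by rewrite ler_wpM2r ?norm1_ge0.
    by rewrite ler_norml => /andP[+ _]; lra.
  lra.
clearbody b G n.
have -> : dotv (b - s *: G) (b - s *: G) =
    dotv b b - 2 * s * dotv G b + s ^+ 2 * dotv G G.
  have -> : b - s *: G = b + (- s) *: G by rewrite scaleNr.
  rewrite !dotvDl !dotvDr !dotvZl !dotvZr (dotvC b G); ring.
have := ler_wpM2l s0 Gb; have := ler_wpM2l (sqr_ge0 s) GG; lra.
Qed.

(** Absorbs the error linear in the distance to a minimizer; this is why the descent is run on 1
    plus the squared distance. *)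
Lemma norm1_le_1Ddotv (R : realType) (d : nat) (b : 'rV[R]_d) :
  norm1 b <= d%:R * (1 + dotv b b).
Proof.
have -> : d%:R * (1 + dotv b b) = \sum_(l < d) (1 + dotv b b).
  by rewrite sumr_const card_ord mulr_natl.
apply: ler_sum => l _; apply: le_trans (_ : 1 + b 0 l ^+ 2 <= _).
  have := sqr_ge0 (`|b 0 l| - 1); rewrite -(real_normK (num_real (b 0 l))).
  have := sqr_ge0 `|b 0 l|.
  by move: `|b 0 l| => a; rewrite sqrrB1 mulr2n; have [] := lerP a 1; nra.
by rewrite lerD2l sqr_coord_le_dotv.
Qed.

Theorem corollary5p2 (R : realType) (N d : nat) (hN : (1 <= N)%N)
    (hd : (1 <= d)%N)
    (f : 'I_N -> 'rV[R]_d -> R)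
    (f_convex : forall i, convex_function [set: 'rV[R]_d] (f i))
    (f_bounded : forall i, (subgradient_sup (f i) < +oo)%E)
    (f_min : exists x, is_minimizer (fun y => \sum_i f i y) x)
    (P : 'M[R]_N) (P_stochastic : row_stochastic P)
    (P_primitive : primitive_mx P)
    (alpha : R) (alpha_range : -1 <= alpha < - (1 / 2))
    (c : R) (c_gt0 : 0 < c)
    (delta : nat -> R) (delta0 : 0 <= delta 0%N)
    (deltaE : forall t : nat, (1 <= t)%N -> delta t = c * (t%:R `^ alpha))
    (x g : 'I_N -> nat -> 'rV[R]_d) (z : 'I_N -> nat -> 'rV[R]_N)
    (g_sub : forall i t, g i t \in subdifferential (f i) (x i t))
    (x_rec : forall i t, x i t.+1 =
      \sum_j P i j *: x j t - (delta t / z i t 0 i) *: g i t)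
    (z_init : forall i, z i 0%N = delta_mx 0 i)
    (z_rec : forall i t, z i t.+1 = \sum_j P i j *: z j t)
    (z_neq0 : forall i t, z i t 0 i != 0) :
  exists xstar : 'rV[R]_d,
    is_minimizer (fun y => \sum_i f i y) xstar /\
    forall i, x i t @[t --> \oo] --> xstar.
Proof.
case: N hN f f_convex f_bounded f_min P P_stochastic P_primitive x g z g_sub
  x_rec z_init z_rec z_neq0 => [//|N'] _ f f_convex f_bounded f_min P P_stochastic
  P_primitive x g z g_sub x_rec z_init z_rec z_neq0.

(* Bounds on subgradients, weights and step sizes *)
have [alpha_ge alpha_lt] := andP alpha_range.
have [L L0 gL] := subgradient_sup_bound f_bounded.
have g_sub' i t : subdifferential (f i) (x i t) (g i t).
  by have := g_sub i t; rewrite inE.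
have fL i u v : f i u - f i v <= L * norm1 (u - v).
  exact: subgradient_lipschitz (f_convex i) (gL i) u v.
have [p [C [r [C0 r01 [p0 p1] pP Pp]]]] :=
  primitive_stochastic_limit P_stochastic P_primitive.
have [r0 r1] := andP r01.
have zP := push_sum_weights z_init z_rec.
(* Entries of [P ^+ t] are nonnegative, so a nonzero weight is positive. *)
have z0 i t : 0 < z i t 0 i.
  rewrite lt_def z_neq0 zP /=; have [Q0 _] := row_stochasticX t P_stochastic.
  exact: Q0.
have [Z Z0 zZ] : exists2 Z, 0 <= Z & forall i t, (z i t 0 i)^-1 <= Z.
  have /choice[Z zZ] i : exists Z, forall t, (z i t 0 i)^-1 <= Z.
    apply: (inv_seq_bounded (p0 i)); apply: (@cvg_exprM _ _ _ C r) => // t.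
    by rewrite zP.
  exists (\sum_i `|Z i|) => [|i t]; first exact: sumr_ge0.
  apply: le_trans (zZ i t) _; apply: le_trans (ler_norm _) _.
  by rewrite (bigD1 i) //= lerDl sumr_ge0.
have delta_ge0 t : 0 <= delta t.
  by case: t => // t; rewrite deltaE // mulr_ge0 ?powR_ge0 // ltW.
(* Index 0 is split off, as [delta 0] does not follow the power law; the other squares decay with
   exponent [alpha * 2 < -1]. *)
have delta_sq : summable_seq (fun t => delta t ^+ 2).
  apply: summable_seqS; first exact: sqr_ge0.
  have /(@summable_powR R) : alpha * 2 < -1 by lra.
  move/(summable_seqZ (sqr_ge0 c)); apply: summable_seq_le => t.
  by rewrite sqr_ge0 deltaE // exprMn powRrM powR_mulrn ?powR_ge0 //=.
(* Since [alpha >= -1], the step sizes dominate [c] times the harmonic terms. *)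
have delta_div M : exists n, M < \sum_(t < n) delta t.
  have [n nM] := harmonic_sum_unbounded (M / c).
  exists n.+1; rewrite big_ord_recl.
  apply: (@lt_le_trans _ _ (\sum_(t < n) delta t.+1)).
    move: nM; rewrite ltr_pdivrMr // => /lt_le_trans; apply.
    rewrite mulr_suml; apply: ler_sum => t _; rewrite deltaE // mulrC ler_pM2l //.
    by rewrite -powR_inv1 // ler_powR // ler1n.
  by rewrite lerDr.

(* Consensus error *)
pose kap := N'.+1%:R * (Z * L).
have kap0 : 0 <= kap by rewrite !mulr_ge0.
(* An envelope common to all coordinates: it starts from the total 1-norm of the initial points, and
   [kap * delta t] bounds the total 1-norm of the subgradient steps. *)
pose u t := iteri t (fun s v => r * v + kap * delta s) (\sum_j norm1 (x j 0%N)).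
have uS t : u t.+1 = r * u t + kap * delta t by [].
have u0 t : 0 <= u t.
  elim: t => [|t IH]; first by apply: sumr_ge0 => j _; exact: norm1_ge0.
  by rewrite uS addr_ge0 // mulr_ge0.
have u_sq : summable_seq (fun t => u t ^+ 2).
  apply: (@summable_geometric_filter _ r u (fun t => kap * delta t)) => // [t|].
    by rewrite mulr_ge0.
  have := summable_seqZ (sqr_ge0 kap) delta_sq; apply: summable_seq_le => t.
  by rewrite sqr_ge0 exprMn /=.
have step_le i t : norm1 ((delta t / z i t 0 i) *: g i t) <= delta t * (Z * L).
  rewrite norm1Z ger0_norm ?divr_ge0 ?(ltW (z0 i t)) // -mulrA ler_wpM2l //.
  by rewrite ler_pM ?invr_ge0 ?norm1_ge0 ?(ltW (z0 i t)) //; exact: gL (g_sub' i t).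
pose m t := \sum_j p j *: x j t.
have xm t i : norm1 (x i t - m t) <= d%:R * (C * u t).
  have -> : d%:R * (C * u t) = \sum_(l < d) C * u t.
    by rewrite sumr_const card_ord mulr_natl.
  apply: ler_sum => l _.
  (* Exponent 0 is taken: [P ^+ 0] is the identity, so the estimated sum is coordinate [l] of
     [x i t - m t]. *)
  have := @consensus_deviation R N'.+1 P p C r (fun j s => x j s 0 l)
    (fun j s => ((delta s / z j s 0 j) *: g j s) 0 l) u C0 r0 pP Pp _ _ _ t 0%N i.
  rewrite expr0 mulr1.
  have -> : \sum_j ((P ^+ 0) i j - p j) * x j t 0 l = (x i t - m t) 0 l.
    rewrite expr0 !mxE summxE; under eq_bigr do rewrite mulrBl.
    rewrite sumrB; congr (_ - _); last by apply: eq_bigr => j _; rewrite mxE.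
    rewrite (bigD1 i) //= mxE eqxx mul1r big1 ?addr0 // => j ji.
    by rewrite mxE eq_sym (negPf ji) mul0r.
  apply.
  - move=> j s; rewrite x_rec !mxE summxE; congr (_ - _).
    by apply: eq_bigr => k _; rewrite mxE.
  - by apply: ler_sum => j _; rewrite /norm1 (bigD1 l) //= lerDl sumr_ge0.
  - move=> s; rewrite uS lerD2l /kap -mulrA mulr_natl -[N'.+1 in leRHS]card_ord.
    rewrite -sumr_const; apply: ler_sum => j _; rewrite (mulrC _ (delta s)).
    apply: le_trans (step_le j s); rewrite /norm1 (bigD1 l) //= lerDl sumr_ge0 //.
(* Stationarity of [p] cancels the mixing; the remaining weights [p i / z i t 0 i] tend to 1. *)
have mS t : m t.+1 = m t - delta t *: \sum_i (p i / z i t 0 i) *: g i t.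
  rewrite /m; under eq_bigr do rewrite x_rec scalerBr scaler_sumr.
  rewrite sumrB exchange_big /=; congr (_ - _).
    apply: eq_bigr => k _; under eq_bigr do rewrite scalerA.
    by rewrite -scaler_suml pP.
  rewrite scaler_sumr; apply: eq_bigr => i _; rewrite !scalerA.
  by congr (_ *: _); ring.
have p_le1 i : p i <= 1.
  by rewrite -p1 (bigD1 i) //= lerDl sumr_ge0 // => j _; rewrite ltW.
have p_ge0 i : 0 <= p i by exact: ltW.
have zV_ge0 i t : 0 <= (z i t 0 i)^-1 by rewrite invr_ge0 ltW.
have wZ t i : `|p i / z i t 0 i| <= Z.
  by rewrite ger0_norm ?mulr_ge0 // -[leRHS]mul1r ler_pM.
have w1 t i : `|p i / z i t 0 i - 1| <= Z * (C * r ^+ t).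
  have -> : p i / z i t 0 i - 1 = (z i t 0 i)^-1 * (p i - z i t 0 i).
    by field.
  rewrite normrM ger0_norm // ler_pM //.
  by rewrite zP distrC.

(* Descent of the average *)
pose F y := \sum_i f i y.
pose n : R := #|'I_N'.+1|%:R.
have n0 : 0 <= n by [].
(* The coefficients come from the one-step estimate with [D = d%:R * (C * u t)],
   [om = Z * (C * r ^+ t)] and [W = Z]; the [d%:R] of the second term comes from bounding the 1-norm
   by [1 + A y t]. *)
pose beta t := 4 * n * L * d%:R * C * (delta t * u t) +
  2 * n * L * Z * C * d%:R * (delta t * r ^+ t) + (n * Z * L) ^+ 2 * delta t ^+ 2.
have beta_sum : summable_seq beta.
  apply: summable_seqD; first apply: summable_seqD.
  - by apply: summable_seqZ; [rewrite !mulr_ge0 | apply: summable_seqM].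
  - apply: summable_seqZ; first by rewrite !mulr_ge0.
    apply: summable_seqM => // [t|]; first exact: exprn_ge0.
    apply: summable_seq_le (summable_expr r01) => t.
    by rewrite sqr_ge0 expr2 /= ler_piMl ?exprn_ge0 // exprn_ile1 // ltW.
  - by apply: summable_seqZ => //; exact: sqr_ge0.
pose A y t := dotv (m t - y) (m t - y).
have A0 y t : 0 <= A y t by apply: sumr_ge0 => l _; rewrite -expr2 sqr_ge0.
have fejer y : is_minimizer F y -> cvgn (A y) /\
    summable_seq (fun t => delta t * (F (m t) - F y)).
  move=> miny.
  have [||||cA sA] := @robbins_siegmund R (fun t => 1 + A y t) beta
      (fun t => 2 * (delta t * (F (m t) - F y))).
  - by move=> t; rewrite addr_ge0.
  - by move=> t; rewrite !mulr_ge0 // subr_ge0.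
  - exact: beta_sum.
  - move=> t.
    have := @sqdist_subgradient_step _ _ _ f (x^~ t) (g^~ t) (m t) y
      (fun i => p i / z i t 0 i) L (d%:R * (C * u t)) Z (Z * (C * r ^+ t)) (delta t)
      (m t.+1) fL (g_sub'^~ t) (fun i => gL i _ _ (g_sub' i t)) (xm t) (wZ t) (w1 t)
      L0 Z0 (delta_ge0 t) (mS t).
    rewrite -/(A y t.+1) -/(A y t) -/(F (m t)) -/(F y) -/n => step.
    have q1 : 0 <= 4 * n * L * d%:R * C * (delta t * u t) by rewrite !mulr_ge0.
    have q2 : 0 <= 2 * n * L * Z * C * (delta t * r ^+ t).
      by rewrite !mulr_ge0 ?exprn_ge0.
    have q3 : 0 <= (n * Z * L) ^+ 2 * delta t ^+ 2 by rewrite mulr_ge0 ?sqr_ge0.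
    have := ler_wpM2l q2 (norm1_le_1Ddotv (m t - y)); rewrite -/(A y t) => q4.
    (* The errors that carry no factor [A y t] are enlarged by [1 + A y t]. *)
    have := mulr_ge0 q1 (A0 y t); have := mulr_ge0 q3 (A0 y t).
    rewrite /beta; lra.
  split.
    have -> : A y = (fun t => 1 + A y t) \- cst 1.
      by apply/funext => t /=; rewrite addrC addKr.
    by apply: is_cvgB => //; exact: is_cvg_cst.
  have := summable_seqZ (_ : 0 <= 2^-1) sA; rewrite invr_ge0 ler0n => /(_ isT).
  by under eq_fun do rewrite mulKf ?pnatr_eq0 //.

(* Identification of the limit *)
have [x0 minx0] := f_min.
have [/cvg_seq_bounded[B [_ BA]] hsum] := fejer x0 minx0.
have h_small := divergent_weights_frequently_small delta_ge0 delta_div hsum.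
(* [tau] need not be increasing: [k <= tau k] already sends it to infinity. *)
have /choice[tau tauP] (k : nat) : exists t, (k <= t)%N /\ F (m t) - F x0 < k.+1%:R^-1.
  have kV : 0 < k.+1%:R^-1 :> R by rewrite invr_gt0.
  by have [t kt ht] := h_small _ kV k; exists t.
have m_bounded t : `|m t| <= d%:R * (1 + (B + 1)) + norm1 x0.
  apply: le_trans (mx_norm_le_norm1 _) _; rewrite -[m t](subrK x0).
  apply: le_trans (norm1D _ _) _; rewrite lerD2r.
  apply: le_trans (norm1_le_1Ddotv _) _; rewrite ler_wpM2l // lerD2l -/(A x0 t).
  apply: le_trans (ler_norm _) _.
  by apply: (BA (B + 1)) => //; rewrite ltrDl.
have [y yP] := bounded_rV_cluster (fun k => m_bounded (tau k)).
(* [F] is Lipschitz, so [F y] exceeds the value at a nearby [m (tau k)] by at most [e / 2], and that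
   value is within [e / 2] of the minimum. The [+ 1] in the radius keeps the divisor positive. *)
have miny : is_minimizer F y.
  move=> v; apply: le_trans (minx0 v); change (F y <= F x0).
  apply/ler_addgt0Pr => e e0.
  have K0 : 0 < n * L * d%:R + 1 by rewrite ltr_wpDl // !mulr_ge0.
  have [k0 k0P] : exists k0 : nat, k0.+1%:R^-1 < e / 2.
    have e2 : 0 < e / 2 by rewrite divr_gt0.
    have [k _ kP] := @near_infty_natSinv_lt R (PosNum e2).
    by exists k; apply: (kP k) => /=.
  have eK : 0 < e / 2 / (n * L * d%:R + 1) by rewrite !divr_gt0.
  have [k kk0 yk] := yP _ eK k0.
  have [_ hk] := tauP k.
  have kle : k.+1%:R^-1 <= k0.+1%:R^-1 :> R by rewrite lef_pV2 ?posrE // ler_nat.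
  have Fy : F y - F (m (tau k)) <= n * L * d%:R * `|y - m (tau k)|.
    rewrite -sumrB.
    apply: le_trans (_ : \sum_(i < N'.+1) L * (d%:R * `|y - m (tau k)|) <= _).
      apply: ler_sum => i _; apply: le_trans (fL _ _ _) _.
      by rewrite ler_wpM2l // norm1_le_mx_norm.
    by rewrite sumr_const -[leLHS]mulr_natl !mulrA.
  have {}Fy : F y - F (m (tau k)) <= e / 2.
    apply: le_trans Fy _.
    move: yk; rewrite ltr_pdivlMr // => yk; apply: le_trans (ltW yk).
    by rewrite mulrC ler_wpM2l // lerDl.
  have {}hk := lt_trans (lt_le_trans hk kle) k0P.
  lra.
have [cA _] := fejer y miny.
have A_cvg0 : A y @ \oo --> 0.
  apply: cvg_frequently_small => // e e0 k.
  have d0 : 0 < d%:R ^+ 2 + 1 :> R by rewrite ltr_wpDl // sqr_ge0.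
  (* The cap 1 lets the squared distance be bounded by the distance itself. *)
  have e1 : 0 < Num.min 1 (e / (d%:R ^+ 2 + 1)) by rewrite lt_min ltr01 divr_gt0.
  have [j kj yj] := yP _ e1 k.
  exists (tau j); first by apply: leq_trans kj _; case: (tauP j).
  move: yj; rewrite lt_min ltr_pdivlMr // => /andP[y1 y2].
  apply: le_lt_trans y2; rewrite /A.
  apply: le_trans (ler_norm _) _; apply: le_trans (normr_dotv_le _ _) _.
  have h := norm1_le_mx_norm (m (tau j) - y); rewrite distrC in h.
  apply: le_trans (ler_pM (norm1_ge0 _) (norm1_ge0 _) h h) _.
  rewrite mulrACA -expr2 mulrDr mulr1 mulrC -[leLHS]addr0 lerD //.
  by rewrite ler_wpM2r ?sqr_ge0 // ler_piMr // ltW.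
exists y; split=> // i; apply/cvgrPdist_lt => e e0.
have d1 : 0 < d%:R + 1 :> R by rewrite ltr_wpDl.
have dC1 : 0 < d%:R * C + 1 by rewrite ltr_wpDl // mulr_ge0.
(* Each error receives half of [e]; the [+ 1] keeps the divisors positive and makes the final
   inequality strict. *)
pose e1 := e / 2 / (d%:R + 1); pose e2 := e / 2 / (d%:R * C + 1).
have e10 : 0 < e1 by rewrite !divr_gt0.
have e20 : 0 < e2 by rewrite !divr_gt0.
have /cvgrPdist_lt/(_ (e1 ^+ 2)) := A_cvg0; rewrite exprn_gt0 // => /(_ isT) nearA.
have /cvgrPdist_lt/(_ (e2 ^+ 2)) := summable_seq_cvg0 u_sq.
rewrite exprn_gt0 // => /(_ isT) nearu.
near=> t.
have At : A y t <= e1 ^+ 2.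
  have : `|0 - A y t| < e1 ^+ 2 by near: t.
  by rewrite sub0r normrN => /ltW; apply: le_trans; exact: ler_norm.
have ut : u t < e2.
  have : `|0 - u t ^+ 2| < e2 ^+ 2 by near: t.
  rewrite sub0r normrN => /(le_lt_trans (ler_norm _)).
  by rewrite ltr_sqr ?nnegrE // ltW.
have ym : norm1 (y - m t) <= d%:R * e1.
  by rewrite -norm1N opprB; apply: norm1_le_dotv => //; exact: ltW.
apply: le_lt_trans (mx_norm_le_norm1 _) _.
rewrite -(subrKA (m t)); apply: le_lt_trans (norm1D _ _) _.
have := xm t i; rewrite -norm1N opprB => mx.
have h1 : d%:R * e1 + e1 = e / 2 by rewrite /e1; field; rewrite gt_eqF.
have h2 : d%:R * C * e2 + e2 = e / 2 by rewrite /e2; field; rewrite gt_eqF.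
have h3 : d%:R * (C * u t) <= d%:R * C * e2.
  by rewrite mulrA ler_wpM2l ?mulr_ge0 // ltW.
lra.
Unshelve. all: by end_near.
Qed.
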